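(* Let $K$ be a field that is complete with respect to a discrete valuation $v$ with finite residue field. Assume that the characteristic of $K$ is not $2$. Let $d\ge 2$ be an integer, and let $T_\infty$ be the infinite $d$-ary rooted tree. Let $K_s$ be a separable closure of $K$. Then the image of any continuous homomorphism $\rho_\infty\colon \mathrm{Gal}(K_s/K)\to \mathrm{Aut}\,T_\infty$ is of infinite index in $\mathrm{Aut}\,T_\infty$.
   Context: For $n\ge 0$ let $T_n$ be the complete $d$-ary rooted tree of height $n$ (with $d^n$ leaves at the top); $T_\infty$ is the increasing union of $T_0\subset T_1\subset T_2\subset\cdots$. $\mathrm{Aut}\,T_\infty$ is the group of automorphisms of the rooted tree, with its profinite topology $\mathrm{Aut}\,T_\infty=\varprojlim_n \mathrm{Aut}\,T_n$. *)

(* Defs.v *)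
From HB Require Import structures.
From mathcomp Require Import all_boot all_order all_algebra separable.
From mathcomp Require Import boolp classical_sets functions cardinality.
From mathcomp Require Import topology.

Set Implicit Arguments.
Unset Strict Implicit.
Unset Printing Implicit Defensive.

Import Order.TTheory GRing.Theory Num.Theory.

Local Open Scope classical_set_scope.
Local Open Scope ring_scope.

(* The value at 0, morally +oo, is irrelevant: all uses below go through
   [val_ge]. The value group is a nonzero subgroup of Z, hence infinite cyclic;
   it is not required to be all of Z. *)
Record discrete_valuation (K : fieldType) := DiscreteValuation {
  dval :> K -> int;
  dvalM : forall x y, x != 0 -> y != 0 -> dval (x * y) = dval x + dval y;
  dvalD : forall x y, x != 0 -> y != 0 -> x + y != 0 ->
    Num.min (dval x) (dval y) <= dval (x + y);
  dval_nontriv : exists2 x, x != 0 & dval x != 0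
}.

Section Valuation.
Variables (K : fieldType) (v : discrete_valuation K).

Definition val_ge (N : int) (x : K) : bool := (x == 0) || (N <= v x).

Definition valuation_cauchy (u : nat -> K) :=
  forall N : int, exists n0 : nat, forall m n : nat,
    (n0 <= m)%N -> (n0 <= n)%N -> val_ge N (u m - u n).

Definition valuation_cvg (u : nat -> K) (l : K) :=
  forall N : int, exists n0 : nat, forall n : nat,
    (n0 <= n)%N -> val_ge N (u n - l).

Definition valuation_complete :=
  forall u, valuation_cauchy u -> exists l, valuation_cvg u l.

Lemma dval1 : v 1 = 0.
Proof.
have := dvalM v (oner_neq0 K) (oner_neq0 K); rewrite mulr1 => e.
by apply: (addrI (v 1)); rewrite addr0 -e.
Qed.

Lemma dvalN x : v (- x) = v x.
Proof.
have [->|x0] := eqVneq x 0; first by rewrite oppr0.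
have n10 : (-1 : K) != 0 by rewrite oppr_eq0 oner_neq0.
have := dvalM v n10 n10; rewrite mulrNN mulr1 dval1 => e.
have {}e : v (-1) = 0.
  by apply/eqP; move/eqP: e; rewrite eq_sym -mulr2n mulrn_eq0.
by rewrite -mulN1r dvalM // e add0r.
Qed.

Lemma val_geB N x y : val_ge N x -> val_ge N y -> val_ge N (x - y).
Proof.
rewrite /val_ge.
have [->|x0] := eqVneq x 0; first by rewrite sub0r oppr_eq0 dvalN.
have [->|y0] := eqVneq y 0; first by rewrite subr0 (negPf x0).
have [//|xy0] /= := eqVneq (x - y) 0 => Nx Ny.
have ny0 : - y != 0 by rewrite oppr_eq0.
by apply: le_trans _ (dvalD v x0 ny0 xy0); rewrite le_min Nx dvalN.
Qed.

Lemma val_geM M N x y : val_ge M x -> val_ge N y -> val_ge (M + N) (x * y).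
Proof.
rewrite /val_ge mulf_eq0.
have [//|x0] := eqVneq x 0; have [//|y0] /= := eqVneq y 0 => Mx Ny.
by rewrite dvalM // lerD.
Qed.

Definition valuation_ring_pred : {pred K} := val_ge 0.

Lemma valuation_ring_closed : subring_closed valuation_ring_pred.
Proof.
split=> [|x y|x y]; rewrite /valuation_ring_pred !unfold_in.
- by rewrite /val_ge dval1 lexx orbT.
- exact: val_geB.
- by rewrite -{3}[0 : int]addr0; exact: val_geM.
Qed.

HB.instance Definition _ :=
  GRing.isSubringClosed.Build K valuation_ring_pred valuation_ring_closed.

Record valuation_ring := ValuationRing {
  vr_val :> K;
  vr_valP : vr_val \in valuation_ring_pred
}.

HB.instance Definition _ := [isSub for vr_val].
HB.instance Definition _ := [Choice of valuation_ring by <:].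
HB.instance Definition _ :=
  [SubChoice_isSubComNzRing of valuation_ring by <:].

(* As [v] is integer-valued, [val_ge 1] is positivity of the valuation. *)
Definition maximal_ideal : {pred valuation_ring} :=
  fun x => val_ge 1 (vr_val x).

Lemma maximal_idealP : idealr_closed maximal_ideal.
Proof.
split=> [||a x y]; rewrite /maximal_ideal !unfold_in /=.
- by rewrite /val_ge eqxx.
- by rewrite /val_ge oner_eq0 dval1.
- move=> x1 y1; rewrite -[y]opprK; apply: val_geB.
    by rewrite -[1 : int]add0r; apply: val_geM => //; exact: vr_valP.
  by rewrite /val_ge oppr_eq0 /= dvalN.
Qed.

HB.instance Definition _ :=
  isIdealr.Build valuation_ring maximal_ideal maximal_idealP.

Definition residue_field := {ideal_quot maximal_ideal}.

End Valuation.

Definition separably_closed (L : fieldType) :=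
  forall p : {poly L}, (1 < size p)%N -> separable_poly p ->
    exists x, root p x.

(* The polynomial [p] below is necessarily the minimal polynomial of [x]. *)
Definition separable_over (K L : fieldType) (iota : {rmorphism K -> L})
    (x : L) :=
  exists p : {poly K}, [/\ p \is monic, irreducible_poly p,
    separable_poly p & root (map_poly iota p) x].

Definition separable_closure (K L : fieldType) (iota : {rmorphism K -> L}) :=
  (forall x, separable_over iota x) /\ separably_closed L.

Section GaloisGroup.
Variables (K L : fieldType) (iota : {rmorphism K -> L}).

Record galois_group := GaloisAut {
  gaut_fun :> L -> L;
  gaut_inv : L -> L;
  gaut_funK : cancel gaut_fun gaut_inv;
  gaut_invK : cancel gaut_inv gaut_fun;
  gautB : forall x y, gaut_fun (x - y) = gaut_fun x - gaut_fun y;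
  gautM : forall x y, gaut_fun (x * y) = gaut_fun x * gaut_fun y;
  gaut1 : gaut_fun 1 = 1;
  gaut_fix : forall a, gaut_fun (iota a) = iota a
}.

Lemma gaut_ext (s t : galois_group) : s =1 t -> s = t.
Proof.
case: s t => [f f' fK f'K fB fM f1 fa] [g g' gK g'K gB gM g1 ga] /= /funext fg.
subst g; have e : f' = g' by apply/funext => x; rewrite -{1}(g'K x) fK.
by subst g'; congr GaloisAut; exact: Prop_irrelevance.
Qed.

Definition gaut_one : galois_group := @GaloisAut id id (fun=> erefl) (fun=> erefl)
  (fun _ _ => erefl) (fun _ _ => erefl) erefl (fun=> erefl).

Definition gaut_mul (s t : galois_group) : galois_group.
Proof.
apply: (@GaloisAut (s \o t) (gaut_inv t \o gaut_inv s)) => [x|x|x y|x y||a] /=.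
- by rewrite !gaut_funK.
- by rewrite !gaut_invK.
- by rewrite !gautB.
- by rewrite !gautM.
- by rewrite !gaut1.
- by rewrite !gaut_fix.
Defined.

Definition gaut_opp (s : galois_group) : galois_group.
Proof.
apply: (@GaloisAut (gaut_inv s) s) => [x|x|x y|x y||a].
- by rewrite gaut_invK.
- by rewrite gaut_funK.
- by rewrite -{1}(gaut_invK s x) -{1}(gaut_invK s y) -gautB gaut_funK.
- by rewrite -{1}(gaut_invK s x) -{1}(gaut_invK s y) -gautM gaut_funK.
- by rewrite -{1}(gaut1 s) gaut_funK.
- by rewrite -{1}(gaut_fix s a) gaut_funK.
Defined.

Lemma gaut_mulA : associative gaut_mul.
Proof. by move=> s t u; exact: gaut_ext. Qed.

Lemma gaut_mul1 : left_id gaut_one gaut_mul.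
Proof. by move=> s; exact: gaut_ext. Qed.

Lemma gaut_mulg1 : right_id gaut_one gaut_mul.
Proof. by move=> s; exact: gaut_ext. Qed.

Lemma gaut_mulV : left_inverse gaut_one gaut_opp gaut_mul.
Proof. by move=> s; apply: gaut_ext => x /=; rewrite gaut_funK. Qed.

Lemma gaut_mulgV : right_inverse gaut_one gaut_opp gaut_mul.
Proof. by move=> s; apply: gaut_ext => x /=; rewrite gaut_invK. Qed.

HB.instance Definition _ := gen_eqMixin galois_group.
HB.instance Definition _ := gen_choiceMixin galois_group.
HB.instance Definition _ :=
  isGroup.Build galois_group gaut_mulA gaut_mul1 gaut_mulg1 gaut_mulV gaut_mulgV.

Definition finite_subextension (E : {pred L}) :=
  [/\ divring_closed E, (forall a, iota a \in E) &
    exists s : seq L, forall x, x \in E ->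
      exists c : 'I_(size s) -> K, x = \sum_i iota (c i) * s`_i].

Definition gaut_fixing (E : {pred L}) : set galois_group :=
  [set t | forall x, x \in E -> t x = x].

Definition krull_subbase : set (set galois_group) :=
  [set U | exists (s : galois_group) (E : {pred L}),
    finite_subextension E /\ U = [set (s * t)%g | t in gaut_fixing E]].

HB.instance Definition _ :=
  isSubBaseTopological.Build galois_group krull_subbase id.

End GaloisGroup.

(* T_oo has the finite words over a d-letter alphabet as vertices, with root
   the empty word; T_n is the subtree of words of length at most n. *)
Section Tree.
Variable d : nat.

Definition vertex := seq 'I_d.

Definition adjacent (u w : vertex) : Prop :=
  exists a : 'I_d, w = rcons u a \/ u = rcons w a.

Record tree_aut := TreeAut {
  tree_fun :> vertex -> vertex;
  tree_inv : vertex -> vertex;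
  tree_funK : cancel tree_fun tree_inv;
  tree_invK : cancel tree_inv tree_fun;
  tree_root : tree_fun [::] = [::];
  tree_adj : forall u w, adjacent (tree_fun u) (tree_fun w) <-> adjacent u w
}.

Lemma tree_ext (s t : tree_aut) : s =1 t -> s = t.
Proof.
case: s t => [f f' fK f'K fr fa] [g g' gK g'K gr ga] /= /funext fg.
subst g; have e : f' = g' by apply/funext => x; rewrite -{1}(g'K x) fK.
by subst g'; congr TreeAut; exact: Prop_irrelevance.
Qed.

Definition tree_one : tree_aut := @TreeAut id id (fun=> erefl) (fun=> erefl)
  erefl (fun _ _ => iff_refl _).

Definition tree_mul (s t : tree_aut) : tree_aut.
Proof.
apply: (@TreeAut (s \o t) (tree_inv t \o tree_inv s)) => [x|x||u w] /=.
- by rewrite !tree_funK.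
- by rewrite !tree_invK.
- by rewrite !tree_root.
- by rewrite !tree_adj.
Defined.

Definition tree_opp (s : tree_aut) : tree_aut.
Proof.
apply: (@TreeAut (tree_inv s) s) => [x|x||u w].
- by rewrite tree_invK.
- by rewrite tree_funK.
- by rewrite -{1}(tree_root s) tree_funK.
- by rewrite -(tree_adj s) !tree_invK.
Defined.

Lemma tree_mulA : associative tree_mul.
Proof. by move=> s t u; exact: tree_ext. Qed.

Lemma tree_mul1 : left_id tree_one tree_mul.
Proof. by move=> s; exact: tree_ext. Qed.

Lemma tree_mulg1 : right_id tree_one tree_mul.
Proof. by move=> s; exact: tree_ext. Qed.

Lemma tree_mulV : left_inverse tree_one tree_opp tree_mul.
Proof. by move=> s; apply: tree_ext => x /=; rewrite tree_funK. Qed.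

Lemma tree_mulgV : right_inverse tree_one tree_opp tree_mul.
Proof. by move=> s; apply: tree_ext => x /=; rewrite tree_invK. Qed.

HB.instance Definition _ := gen_eqMixin tree_aut.
HB.instance Definition _ := gen_choiceMixin tree_aut.
HB.instance Definition _ :=
  isGroup.Build tree_aut tree_mulA tree_mul1 tree_mulg1 tree_mulV tree_mulgV.

(* Fibres of the restriction maps from Aut T_oo to the finite discrete groups
   Aut T_n; they generate the inverse limit topology. *)
Definition profinite_subbase : set (set tree_aut) :=
  [set U | exists (s : tree_aut) (n : nat),
    U = [set t : tree_aut | forall u : vertex, (size u <= n)%N -> t u = s u]].

HB.instance Definition _ :=
  isSubBaseTopological.Build tree_aut profinite_subbase id.

End Tree.

Definition left_cosets (G : groupType) (H : set G) : set (set G) :=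
  [set [set (g * h)%g | h in H] | g in [set: G]].

Definition infinite_index (G : groupType) (H : set G) : Prop :=
  infinite_set (left_cosets H).

(* Main.v *)
From HB Require Import structures.
Require Import Defs.
From mathcomp Require Import all_boot all_order all_algebra perm separable.
From mathcomp Require Import finmap.
From mathcomp Require Import boolp classical_sets functions cardinality.
From mathcomp Require Import topology.
From mathcomp Require Import ring zify.

Set Implicit Arguments.
Unset Strict Implicit.
Unset Printing Implicit Defensive.

Local Open Scope classical_set_scope.
Local Open Scope ring_scope.

Import Order.TTheory GRing.Theory Num.Theory.

(** The obstruction is that [Aut T_oo] has infinitely many independent
    characters of order 2, while [Gal(Ks / K)] has only finitely many.

    On the tree side, every level [n] carries the character [level_sign n], the
    signature of the action on the [d ^ n] words of length [n]. The automorphism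
    [swap n] exchanges two sibling subtrees whose roots lie on level [n.+1]: it
    is trivial up to level [n] and a single transposition on level [n.+1], so the
    values [level_sign m.+1 (swap n)] form a triangular matrix with ones on the
    diagonal.

    On the field side, Hensel's lemma and the finiteness of the residue field
    show that the group of square classes of [K] is finite
    ([finite_square_classes]); this is where characteristic 2 must be excluded.
    By Kummer theory a continuous character [chi] of order at most 2 is the
    action on a square root of some [a] in [K], and [chi] depends only on the
    square class of [a] ([finite_smooth_characters]). This needs two facts of
    Galois theory: a continuous character has an eigenvector in [Ks]
    ([character_eigenvector]), and the square of this eigenvector, being fixed by
    the Galois group, lies in [K] ([galois_fixed]); the latter rests on the
    extension of embeddings to [Ks], by Zorn's lemma ([embedding_total]).

    Suppose now that the image [H] of [rho] has finite index. There are finitely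
    many possible characters [level_sign n.+1 \o rho] and finitely many cosets
    [swap n * H], so three indices [m < k < l] give the same character and the
    same coset. Write [swap k = swap l * rho s]. Then [rho s] is even on level
    [m.+1], where both swaps are trivial, and odd on level [k.+1], where only
    [swap k] acts; but both signs are values at [s] of the same character of the
    Galois group. *)

(** * Square classes of a local field *)

Section LocalField.
Variables (K : fieldType) (v : discrete_valuation K).

Lemma val_ge_trans M N x : M <= N -> val_ge v N x -> val_ge v M x.
Proof.
by move=> MN; rewrite /val_ge => /orP[->//|/(le_trans MN)->]; rewrite orbT.
Qed.

Lemma val_geN N x : val_ge v N (- x) = val_ge v N x.
Proof. by rewrite /val_ge oppr_eq0 dvalN. Qed.

Lemma val_ge0 N : val_ge v N 0.
Proof. by rewrite /val_ge eqxx. Qed.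

Lemma val_geD N x y : val_ge v N x -> val_ge v N y -> val_ge v N (x + y).
Proof. by move=> xN yN; rewrite -[y]opprK val_geB // val_geN. Qed.

Lemma dvalV x : x != 0 -> v x^-1 = - v x.
Proof.
move=> x0; apply/eqP; rewrite -addr_eq0 -dvalM ?invr_eq0 // mulVf //.
by rewrite dval1.
Qed.

Lemma dval_exprz x (n : int) : x != 0 -> v (x ^ n) = n * v x.
Proof.
move=> x0; suff e (m : nat) : v (x ^+ m) = m%:Z * v x.
  by case: n => m; rewrite ?NegzE -?exprnN -?exprnP ?dvalV ?expf_neq0 // e ?mulNr.
elim: m => [|m IH]; first by rewrite expr0 dval1 mul0r.
by rewrite exprS dvalM ?expf_neq0 // IH -addn1 PoszD mulrDl mul1r addrC.
Qed.

(** The value group is a subgroup of [int], generated by its least positive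
    element. *)
Lemma uniformizer : exists p, [/\ p != 0, 0 < v p &
  forall x, x != 0 -> exists m : int, v x = m * v p].
Proof.
pose P n := `[< exists2 x, x != 0 & v x = n.+1%:Z >].
have exP : exists n, P n.
  have [x x0 vx] := dval_nontriv v.
  have [| |e] := ltgtP (v x) 0; last by rewrite e eqxx in vx.
    move=> neg; exists `|v x|.-1%N; apply/asboolP; exists x^-1; rewrite ?invr_eq0 //.
    rewrite dvalV //; lia.
  move=> pos; exists `|v x|.-1%N; apply/asboolP; exists x => //; lia.
case: (ex_minnP exP) => n /asboolP[p p0 vp] minn; exists p.
split=> [//||x x0]; first by rewrite vp.
exists (v x %/ v p)%Z; apply/eqP.
rewrite {1}(divz_eq (v x) (v p)) -subr_eq0 addrAC subrr add0r.
apply: contraT => nz.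
have vp0 : v p != 0 by rewrite vp.
have r0 := modz_ge0 (v x) vp0; have := ltz_mod (v x) vp0; rewrite vp => rlt.
have /minn : P `|(v x %% v p)%Z|.-1%N.
  apply/asboolP; exists (x * p ^ (- (v x %/ v p)%Z)).
    by rewrite mulf_neq0 // expfz_neq0.
  rewrite dvalM ?expfz_neq0 // dval_exprz // {1}(divz_eq (v x) (v p)); lia.
by move: nz r0 rlt; rewrite vp; lia.
Qed.

Hypothesis complete : valuation_complete v.

(** The map [z |-> w - z ^+ 2] contracts the maximal ideal, so its iterates from
    [0] converge to a fixed point. *)
Lemma hensel_quadratic w : val_ge v 1 w -> exists z, z + z ^+ 2 = w.
Proof.
move=> w1; pose u := fix u n := if n is n'.+1 then w - u n' ^+ 2 else 0.
have uS n : u n.+1 = w - u n ^+ 2 by [].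
have u1 n : val_ge v 1 (u n).
  elim: n => [|n IH]; first exact: val_ge0.
  rewrite uS val_geB // expr2; apply: (@val_ge_trans _ (1 + 1)) => //.
  exact: val_geM.
have du n : val_ge v n%:Z (u n.+1 - u n).
  elim: n => [|n IH].
    by rewrite subr0 -[u 1%N]/(w - 0 ^+ 2) expr2 mul0r subr0; apply: val_ge_trans w1.
  have -> : u n.+2 - u n.+1 = - ((u n.+1 + u n) * (u n.+1 - u n)).
    by rewrite !uS; ring.
  by rewrite val_geN intS; apply: val_geM => //; apply: val_geD.
have ddu n k : val_ge v n%:Z (u (n + k)%N - u n).
  elim: k => [|k IH]; first by rewrite addn0 subrr val_ge0.
  have -> : u (n + k.+1)%N - u n =
      (u (n + k).+1 - u (n + k)%N) + (u (n + k)%N - u n).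
    by rewrite addnS; ring.
  apply: val_geD => //; apply: val_ge_trans (du _); lia.
have cu : valuation_cauchy v u.
  move=> N; exists `|N|%N => m n Nm Nn.
  have -> : u m - u n = (u m - u `|N|%N) - (u n - u `|N|%N) by ring.
  apply: (@val_ge_trans _ `|N|%N%:Z); first by lia.
  by rewrite -(subnKC Nm) -(subnKC Nn) val_geB.
have [z uz] := complete cu; exists z; apply/eqP; rewrite -subr_eq0.
(* An element of arbitrarily large valuation vanishes. *)
suff zN N : val_ge v N (z + z ^+ 2 - w).
  by have := zN (v (z + z ^+ 2 - w) + 1); rewrite /val_ge; case: eqP => //= _; lia.
wlog N1 : N / 1 <= N.
  move=> h; have [/h//|N1] := lerP 1 N.
  by apply: val_ge_trans (h 1 _) => //; lia.
have [n0 uzn] := uz N.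
have z1 : val_ge v 1 z.
  have -> : z = u n0 - (u n0 - z) by ring.
  by apply: val_geB => //; apply: val_ge_trans (uzn _ _).
have -> : z + z ^+ 2 - w =
    - (u n0.+1 - z) - (u n0 - z) * (u n0 + z) by rewrite uS; ring.
apply: val_geB; first by rewrite val_geN; apply: uzn.
apply: (@val_ge_trans _ (N + 0)); first by rewrite addr0.
apply: val_geM; first exact: uzn.
by apply: val_geD; apply: (@val_ge_trans _ 1).
Qed.

Hypothesis two : (2%:R : K) != 0.

(** Completing the square: [1 + 4 * w = (1 + 2 * z) ^+ 2] if and only if
    [z + z ^+ 2 = w], which [hensel_quadratic] solves for [w] in the maximal
    ideal. The bound is the valuation of [4] plus one. *)
Lemma square_near_one x : val_ge v (2 * v 2%:R + 1) (x - 1) ->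
  exists c, x = c ^+ 2.
Proof.
move=> x1; have four : (4%:R : K) != 0 by rewrite (natrM _ 2 2) mulf_neq0.
have v4 : v 4%:R = 2 * v 2%:R by rewrite (natrM _ 2 2) dvalM // [RHS]mulrDl mul1r.
have [|z zE] := @hensel_quadratic ((x - 1) / 4%:R).
  have := @val_geM _ v _ (- (2 * v 2%:R)) _ 4%:R^-1 x1.
  rewrite addrAC subrr add0r; apply; rewrite /val_ge dvalV // v4 lexx orbT //.
exists (1 + 2%:R * z); rewrite -[LHS](subrK 1) -[x - 1](divfK four) -zE; ring.
Qed.

Hypothesis residue_finite : finite_set [set: residue_field v].

Lemma residue_reps : exists s : seq K, forall x, val_ge v 0 x ->
  exists y, [/\ y \in s, val_ge v 0 y & val_ge v 1 (x - y)].
Proof.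
have /finite_seqP[s sE] := residue_finite.
exists [seq vr_val (repr q) | q <- s] => x x0.
pose X : valuation_ring v := ValuationRing x0.
pose q := \pi_(residue_field v)%qT X.
exists (vr_val (repr q)); split.
- by apply: map_f; have : [set: residue_field v] q by []; rewrite sE.
- exact: vr_valP (repr q).
- have : (X == repr q %[mod residue_field v])%qT by rewrite reprK.
  by rewrite -Quotient.idealrBE unfold_in.
Qed.

(** Digit expansion: [n] digits, each a representative of a residue class,
    determine an integer modulo valuation [n]. *)
Lemma residue_power_reps (n : nat) : exists s : seq K, forall x,
  val_ge v 0 x -> exists2 y, y \in s & val_ge v n%:Z (x - y).
Proof.
have [p [p0 vp mul]] := uniformizer; have [s1 s1P] := residue_reps.
elim: n => [|n [s sP]].
  by exists [:: 0] => x x0; exists 0; rewrite ?inE ?eqxx // subr0.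
exists [seq a + p * b | a <- s1, b <- s] => x /s1P[a [as1 _ xa]].
have [|b bs xab] := sP ((x - a) / p).
  move: xa; rewrite /val_ge mulf_eq0 => /orP[->//|].
  have [//|xa0 /= xa] := eqVneq (x - a) 0.
  rewrite dvalM ?invr_eq0 // dvalV //; have [m mE] := mul _ xa0.
  rewrite mE in xa *; have m0 : 0 < m by rewrite -(pmulr_lgt0 _ vp).
  have : 0 <= (m - 1) * v p by apply: mulr_ge0; [lia | exact: ltW].
  by rewrite mulrBl mul1r => ->; rewrite orbT.
exists (a + p * b); first by apply/allpairsP; exists (a, b).
have -> : x - (a + p * b) = ((x - a) / p - b) * p.
  by rewrite mulrBl divfK // mulrC; ring.
rewrite -addn1 PoszD; apply: val_geM => //; rewrite /val_ge; lia.
Qed.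

(** Up to even powers of a uniformizer, an element is a unit or a uniformizer
    times a unit; up to squares, a unit depends only on its class modulo
    valuation [v 4 + 1], by [square_near_one]. *)
Lemma finite_square_classes : exists R : seq K, forall a, a != 0 ->
  exists r c, [/\ r \in R, c != 0 & a = r * c ^+ 2].
Proof.
have [p [p0 vp mul]] := uniformizer.
have v2 : 0 <= v 2%:R.
  have := dvalD v (oner_neq0 K) (oner_neq0 K).
  by rewrite -(natrD _ 1 1) dval1 => /(_ two).
have [s sP] := residue_power_reps (absz (2 * v 2%:R + 1)).
have {sP} : forall u, u != 0 -> v u = 0 ->
    exists l c, [/\ l \in s, c != 0 & u = l * c ^+ 2].
  move=> u u0 vu; have [|l ls ul] := sP u; first by rewrite /val_ge vu orbT.
  rewrite gez0_abs in ul; last lia.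
  have l0 : l != 0.
    apply: contraTneq ul => ->; rewrite subr0 /val_ge (negPf u0) /= vu; lia.
  (* [l] is a unit, as it is congruent to the unit [u]. *)
  have vl : v l <= 0.
    rewrite leNgt; apply/negP => vl.
    have : val_ge v 1 u.
      rewrite -(subrK l u); apply: val_geD; first by apply: val_ge_trans ul; lia.
      by rewrite /val_ge; apply/orP; right; lia.
    by rewrite /val_ge (negPf u0) vu.
  have [|c cE] := @square_near_one (u / l).
    have -> : u / l - 1 = (u - l) / l by rewrite mulrBl divff.
    rewrite -[_ + 1]addr0; apply: val_geM => //.
    by rewrite /val_ge dvalV // oppr_ge0 vl orbT.
  exists l, c; split => //; last by rewrite -cE mulrC divfK.
  have : u / l != 0 by rewrite mulf_neq0 ?invr_eq0.
  by rewrite cE sqrf_eq0.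
move=> sP; exists (s ++ [seq p * x | x <- s]) => a a0.
have [m mE] := mul _ a0.
pose q := (m %/ 2)%Z; pose r := (m %% 2)%Z.
have pz n : p ^ n != 0 by rewrite expfz_neq0.
have [||l [c [ls c0 lE]]] := sP (a * p ^ (- m)).
- by rewrite mulf_neq0.
- by rewrite dvalM // dval_exprz // mE mulNr subrr.
have aE : a = l * c ^+ 2 * p ^ m.
  by rewrite -lE -mulrA -expfzDr // addNr expr0z mulr1.
have pq : p ^ (q * 2) = (p ^ q) ^+ 2 by rewrite -exprz_exp.
have : r = 0 \/ r = 1 by rewrite /r; lia.
have mqr : m = q * 2 + r by rewrite /q /r -divz_eq.
move=> [] rE.
- exists l, (c * p ^ q); rewrite mem_cat ls mulf_neq0 //; split => //.
  by rewrite aE mqr rE addr0 pq; ring.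
- exists (p * l), (c * p ^ q).
  rewrite mem_cat map_f ?orbT // mulf_neq0 //; split=> //.
  by rewrite aE mqr rE expfzDr // pq expr1z; ring.
Qed.
End LocalField.

(** * Extension of embeddings and the fixed field *)

(** The polynomials vanishing at [x] along [i] are the multiples of a minimal
    polynomial [m]; any root of the image of [m] along [f] may serve as [y], and
    there is one because [m], a divisor of [p], is separable. *)
Lemma conjugate_root (E L : fieldType) (i f : {rmorphism E -> L}) (x : L)
    (p : {poly E}) :
  separably_closed L -> separable_poly p -> root (map_poly i p) x ->
  exists y, forall q, root (map_poly i q) x -> root (map_poly f q) y.
Proof.
move=> Lsc sep_p px.
pose P n := `[< exists q : {poly E},
  [/\ q != 0, size q = n & root (map_poly i q) x] >].
have exP : exists n, P n.
  by exists (size p); apply/asboolP; exists p; rewrite separable_poly_neq0.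
case: (ex_minnP exP) => n /asboolP[m [m0 <- mx]] minm.
have mdvd q : root (map_poly i q) x -> m %| q.
  move=> qx; apply/modp_eq0P; apply: contraTeq (ltn_modpN0 q m0) => r0.
  rewrite -leqNgt; apply: minm; apply/asboolP; exists (q %% m); split=> //.
  move: qx; rewrite {1}(divp_eq q m) rmorphD rmorphM /= !rootE hornerD hornerM.
  by rewrite (rootP mx) mulr0 add0r.
have [||y my] := Lsc (map_poly f m).
- rewrite size_map_poly ltnNge; apply/negP => m1.
  move: mx m0; rewrite (size1_polyC m1) map_polyC rootC fmorph_eq0 polyC_eq0.
  by move=> /eqP->; rewrite eqxx.
- by rewrite separable_map (dvdp_separable (mdvd _ px)).
exists y => q /mdvd/divpK <-.
by rewrite rmorphM /= rootM my orbT.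
Qed.

Section Embeddings.
Variables (K L : fieldType) (iota : {rmorphism K -> L}).

(** The graphs of the [K]-algebra morphisms from a subring of [L] to [L]: such a
    graph is a subring of [L * L] containing the diagonal of [K], and it is
    functional as soon as it is so above [0]. Graphs turn the union of a chain of
    morphisms into a union of sets. *)
Definition embedding_graph (G : set (L * L)) :=
  [/\ forall a, G (iota a, iota a),
      forall z w, G z -> G w -> G (z - w),
      forall z w, G z -> G w -> G (z * w) &
      forall y, G (0, y) -> y = 0].

Lemma graph_poly G x y (q : {poly K}) : embedding_graph G -> G (x, y) ->
  G ((map_poly iota q).[x], (map_poly iota q).[y]).
Proof.
case=> Gi GB GM _ Gxy.
have GD z w : G z -> G w -> G (z + w).
  move=> Gz Gw; rewrite -[w]opprK; apply: (GB) => //; rewrite -sub0r.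
  by apply: GB => //; have := Gi 0; rewrite rmorph0.
elim/poly_ind: q => [|q c IH].
  by rewrite rmorph0 !horner0; have := Gi 0; rewrite rmorph0.
rewrite rmorphD rmorphM /= map_polyX map_polyC !hornerE.
exact: GD (GM _ _ IH Gxy) (Gi c).
Qed.

(** The graph of [q(x) |-> f(q)(y)], the extension of the embedding [f] that
    sends [x] to [y]. *)
Definition adjoin_graph (E : fieldType) (i f : {rmorphism E -> L}) x y :
    set (L * L) :=
  [set ((map_poly i q).[x], (map_poly f q).[y]) | q in [set: {poly E}]].

Lemma adjoin_graphP (E : fieldType) (i f : {rmorphism E -> L}) (j : K -> E) x y :
  i \o j =1 iota -> f \o j =1 iota ->
  (forall q, root (map_poly i q) x -> root (map_poly f q) y) ->
  embedding_graph (adjoin_graph i f x y).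
Proof.
move=> ij fj xy; split.
- move=> a; exists (j a)%:P => //; rewrite !map_polyC !hornerC.
  by congr pair; [exact: ij | exact: fj].
- move=> _ _ [p _ <-] [q _ <-]; exists (p - q) => //.
  by rewrite !rmorphB !hornerD !hornerN.
- move=> _ _ [p _ <-] [q _ <-]; exists (p * q) => //.
  by rewrite !rmorphM !hornerM.
- by move=> z [q _ [qx <-]]; apply/rootP/xy/rootP.
Qed.

(** The inverse of a nonzero algebraic element is a polynomial in it, and the
    same polynomial inverts its image. Hence the domain of an embedding is a
    field. *)
Lemma graphV G x y :
    (exists p : {poly K}, irreducible_poly p /\ root (map_poly iota p) x) ->
  embedding_graph G -> G (x, y) -> G (x^-1, y^-1).
Proof.
move=> [p [irr px]] Gg Gxy; have [Gi GB GM G0] := Gg.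
have [x0|x0] := eqVneq x 0.
  by move: Gxy; rewrite x0 => Gxy; rewrite (G0 _ Gxy) invr0 -{2}(G0 _ Gxy).
have y0 : root (map_poly iota p) y.
  by rewrite rootE; apply/eqP/G0; rewrite -(rootP px); apply: graph_poly.
have p0 : ~~ root p 0.
  rewrite root_factor_theorem subr0; apply/negP => Xp.
  have e : 'X %= p by apply: irr Xp; rewrite size_polyX.
  have /eqp_root eX : map_poly iota 'X %= map_poly iota p by rewrite eqp_map.
  by move: px; rewrite -eX map_polyX rootX (negPf x0).
(* With [p = c + 'X * q], every root [z] of [p] has [z^-1 = - q(z) / c]. *)
set c := p.[0] in p0; have c0 : iota c != 0 by rewrite fmorph_eq0.
have /factor_theorem[q qE] : root (p - c%:P) 0.
  by rewrite rootE hornerD hornerN hornerC subrr.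
rewrite polyC0 subr0 in qE; have invE z : root (map_poly iota p) z ->
    z^-1 = iota (- c^-1) * (map_poly iota q).[z].
  move=> /rootP pz.
  have e : (map_poly iota q).[z] * z = - iota c.
    apply/eqP; rewrite -addr_eq0 -pz -[in X in _ == X](subrK c%:P p) qE.
    by rewrite rmorphD rmorphM /= map_polyX map_polyC !hornerE.
  have z0 : z != 0.
    by apply: contra_neq c0 => z0; rewrite -[iota c]opprK -e z0 mulr0 oppr0.
  apply: (mulIf z0); rewrite mulVf // -mulrA e rmorphN mulrNN fmorphV mulVf //.
rewrite !invE //; exact: (GM _ _ (Gi (- c^-1)) (graph_poly q Gg Gxy)).
Qed.

Hypothesis algebraic : forall x, separable_over iota x.
Hypothesis closed : separably_closed L.

Section Extension.
Variables (G : set (L * L)) (hG : embedding_graph G).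

Definition graph_dom : {pred L} := fun x => `[< exists y, G (x, y) >].

Lemma graph_dom_closed : divring_closed graph_dom.
Proof.
have [Gi GB GM _] := hG; split=> [|x y|x y].
- by apply/asboolP; exists (iota 1); have := Gi 1; rewrite rmorph1.
- move=> /asboolP[x' Gx] /asboolP[y' Gy]; apply/asboolP; exists (x' - y').
  exact: (GB _ _ Gx Gy).
- move=> /asboolP[x' Gx] /asboolP[y' Gy]; apply/asboolP; exists (x' / y').
  have alg : exists p, irreducible_poly p /\ root (map_poly iota p) y.
    by have [p [? ? ? ?]] := algebraic y; exists p.
  exact: (GM _ _ Gx (graphV alg hG Gy)).
Qed.

HB.instance Definition _ :=
  GRing.isDivringClosed.Build L graph_dom graph_dom_closed.

(** The domain of the embedding as a field type, so that polynomial division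
    over it, hence [conjugate_root], is available. *)
Record graph_field := GraphField {
  gf_val :> L;
  gf_valP : gf_val \in graph_dom
}.

HB.instance Definition _ := [isSub for gf_val].
HB.instance Definition _ := [Choice of graph_field by <:].
HB.instance Definition _ :=
  [SubChoice_isSubComUnitRing of graph_field by <:].
HB.instance Definition _ :=
  [SubComUnitRing_isSubIntegralDomain of graph_field by <:].
HB.instance Definition _ :=
  [SubIntegralDomain_isSubField of graph_field by <:].

Definition graph_map (x : graph_field) : L := sval (cid (asboolW (gf_valP x))).

Lemma graph_mapP (x : graph_field) : G (val x, graph_map x).
Proof. exact: svalP (cid (asboolW (gf_valP x))). Qed.

Lemma graph_functional x y z : G (x, y) -> G (x, z) -> y = z.
Proof.
have [_ GB _ G0] := hG => Gy Gz; apply/eqP; rewrite -subr_eq0; apply/eqP/G0.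
by rewrite -(subrr x); exact: (GB _ _ Gy Gz).
Qed.

Lemma graph_map_is_zmod : zmod_morphism graph_map.
Proof.
have [_ GB _ _] := hG => x y; apply: (graph_functional (graph_mapP _)).
rewrite rmorphB; exact: (GB _ _ (graph_mapP x) (graph_mapP y)).
Qed.

Lemma graph_map_is_monoid : monoid_morphism graph_map.
Proof.
have [Gi _ GM _] := hG; split=> [|x y]; apply: (graph_functional (graph_mapP _)).
  by rewrite rmorph1; have := Gi 1; rewrite rmorph1.
rewrite rmorphM; exact: (GM _ _ (graph_mapP x) (graph_mapP y)).
Qed.

HB.instance Definition _ :=
  GRing.isZmodMorphism.Build graph_field L graph_map graph_map_is_zmod.
HB.instance Definition _ :=
  GRing.isMonoidMorphism.Build graph_field L graph_map graph_map_is_monoid.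

Lemma graph_dom_iota a : iota a \in graph_dom.
Proof. by have [Gi _ _ _] := hG; apply/asboolP; exists (iota a). Qed.

Definition graph_base a : graph_field := GraphField (graph_dom_iota a).

Lemma graph_base_is_zmod : zmod_morphism graph_base.
Proof. by move=> x y; apply: val_inj; rewrite rmorphB /= rmorphB. Qed.

Lemma graph_base_is_monoid : monoid_morphism graph_base.
Proof.
split=> [|x y]; apply: val_inj; first by rewrite rmorph1 /= rmorph1.
by rewrite rmorphM /= rmorphM.
Qed.

HB.instance Definition _ :=
  GRing.isZmodMorphism.Build K graph_field graph_base graph_base_is_zmod.
HB.instance Definition _ :=
  GRing.isMonoidMorphism.Build K graph_field graph_base graph_base_is_monoid.

(** Choose the image of [x] among the conjugates, with respect to the embedding
    of graph [G], of [x] over the domain of [G]. *)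
Lemma embedding_extend x : exists G', [/\ embedding_graph G', G `<=` G' &
  exists y, G' (x, y)].
Proof.
have [p [_ irr sep px]] := algebraic x.
pose i : {rmorphism graph_field -> L} := val.
have [||y yP] := @conjugate_root _ _ i graph_map x (map_poly graph_base p) closed.
- by rewrite separable_map.
- by rewrite -map_poly_comp.
have bi a : graph_map (graph_base a) = iota a.
  have [Gi _ _ _] := hG.
  exact: (graph_functional (graph_mapP (graph_base a)) (Gi a)).
exists (adjoin_graph i graph_map x y); split.
- exact: (@adjoin_graphP _ _ _ graph_base).
- move=> [a b] Gab; have aD : a \in graph_dom by apply/asboolP; exists b.
  exists (GraphField aD)%:P => //; rewrite !map_polyC !hornerC; congr pair.
  exact: graph_functional (graph_mapP (GraphField aD)) Gab.
- by exists y, 'X => //; rewrite !map_polyX !hornerX.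
Qed.
End Extension.

Lemma embedding_bigcup (F : set (set (L * L))) :
  F !=set0 -> total_on F subset -> (forall G, F G -> embedding_graph G) ->
  embedding_graph (\bigcup_(G in F) G).
Proof.
move=> [G0 FG0] Ftot Femb.
have common z w : (\bigcup_(G in F) G) z -> (\bigcup_(G in F) G) w ->
    exists G, [/\ F G, G z & G w].
  move=> [G FG Gz] [H FH Hw]; have [GH|HG] := Ftot _ _ FG FH.
  - by exists H; split=> //; exact: GH.
  - by exists G; split=> //; exact: HG.
split.
- by move=> a; exists G0 => //; have [] := Femb _ FG0.
- move=> z w zF wF; have [G [FG Gz Gw]] := common _ _ zF wF; exists G => //.
  by have [_ + _ _] := Femb _ FG; exact.
- move=> z w zF wF; have [G [FG Gz Gw]] := common _ _ zF wF; exists G => //.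
  by have [_ _ + _] := Femb _ FG; exact.
- by move=> y [G FG Gy]; have [_ _ _] := Femb _ FG; exact.
Qed.

(** Zorn's lemma: by [embedding_extend], a maximal embedding is total. The empty
    graph is admitted only to bound the empty chain. *)
Lemma embedding_total G0 : embedding_graph G0 ->
  exists G, [/\ embedding_graph G, G0 `<=` G & forall x, exists y, G (x, y)].
Proof.
move=> hG0; pose P (G : set (L * L)) := G = set0 \/ (G0 `<=` G /\ embedding_graph G).
have G0n : G0 (0, 0) by have [Gi _ _ _] := hG0; have := Gi 0; rewrite rmorph0.
have [|G [PG Gmax]] := @Zorn_bigcup _ P.
  move=> F FP Ftot; have [/eqP|/set0P] := boolP (\bigcup_(G in F) G == set0).
    by left.
  move=> [z [G1 FG1 G1z]]; right.
  pose F' := F `&` [set G | G <> set0].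
  have -> : \bigcup_(G in F) G = \bigcup_(G in F') G.
    apply/seteqP; split=> [w [G FG Gw]|w [G [FG _] Gw]]; exists G => //.
    by split=> // G_0; rewrite G_0 in Gw.
  have F'P G : F' G -> G0 `<=` G /\ embedding_graph G.
    by move=> [/FP[->|] //].
  have F'1 : F' G1 by split=> // G_0; rewrite G_0 in G1z.
  split; first by move=> w G0w; exists G1 => //; have [+ _] := F'P _ F'1; exact.
  apply: embedding_bigcup; first by exists G1.
  - by move=> A B [FA _] [FB _]; exact: Ftot.
  - by move=> A /F'P[].
have [G0G hG] : G0 `<=` G /\ embedding_graph G.
  case: PG => // G_0; case: (Gmax G0); last by right; split.
  by rewrite G_0; split=> // /(_ _ G0n).
exists G; split=> // x; have [G' [hG' GG' [y G'xy]]] := embedding_extend hG x.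
exists y; apply: contrapT => nGxy; apply: (Gmax G').
  by split=> // G'G; apply: nGxy; exact: G'G.
by right; split=> //; exact: subset_trans GG'.
Qed.

End Embeddings.

Lemma finite_roots (L : fieldType) (p : {poly L}) : p != 0 -> finite_set (root p).
Proof.
have [n] := ubnP (size p); elim: n p => // n IH p pn p0.
have [[x px]|nr] := pselect (exists x, root p x); last first.
  suff -> : (root p : set L) = set0 by [].
  by apply/seteqP; split=> // x px; case: nr; exists x.
have [q qE] := factor_theorem _ _ px.
have q0 : q != 0 by apply: contra_neq p0; rewrite qE => ->; rewrite mul0r.
have qn : (size q < n)%N.
  by move: pn; rewrite qE size_Mmonic ?monicXsubC // size_XsubC addn2 /= ltnS.
apply: (@sub_finite_set _ _ (root q `|` [set x])).
  by move=> y /= ; rewrite qE rootM root_XsubC => /orP[|/eqP]; [left|right].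
by rewrite finite_setU; split=> //; exact: IH.
Qed.

Section Galois.
Variables (K L : fieldType) (iota : {rmorphism K -> L}).
Hypothesis Lclosure : separable_closure iota.

(** A [K]-endomorphism of an algebraic extension is onto because it permutes the
    finitely many roots of each polynomial over [K]. *)
Lemma graph_automorphism (G : set (L * L)) : embedding_graph iota G ->
  (forall x, exists y, G (x, y)) ->
  exists t : galois_group iota, forall x, G (x, t x).
Proof.
move=> hG Gtot; have [Gi GB GM G0] := hG; have [alg _] := Lclosure.
pose f x := sval (cid (Gtot x)).
have fP x : G (x, f x) by exact: svalP (cid (Gtot x)).
have fun_ := graph_functional hG.
have fB x y : f (x - y) = f x - f y.
  exact: fun_ (fP _) (GB _ _ (fP x) (fP y)).
have fM x y : f (x * y) = f x * f y.
  exact: fun_ (fP _) (GM _ _ (fP x) (fP y)).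
have fi a : f (iota a) = iota a by exact: fun_ (fP _) (Gi a).
have f1 : f 1 = 1 by rewrite -(rmorph1 iota) fi.
have f_inj : injective f.
  move=> x y fxy; apply/eqP; rewrite -subr_eq0; apply: contraT => nz.
  have := fM (x - y) (x - y)^-1; rewrite divff // fB fxy subrr mul0r f1.
  by move/eqP; rewrite oner_eq0.
have f_surj y : exists x, f x = y.
  have [p [_ irr _ py]] := alg y.
  have p0 : map_poly iota p != 0 by rewrite map_poly_eq0 irredp_neq0.
  have /finite_seqP[s sE] := finite_roots p0.
  have rs x : root (map_poly iota p) x -> x \in s.
    by move=> px; have : [set` s] x by rewrite -sE.
  have sr x : x \in s -> root (map_poly iota p) x.
    by move=> xs; have : [set` s] x by []; rewrite -sE.
  have [|||_ e] := @uniq_min_size _ [seq f x | x <- undup s] (undup s).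
  - by rewrite map_inj_uniq // undup_uniq.
  - move=> _ /mapP[x + ->]; rewrite !mem_undup => /sr/rootP px; apply/rs/rootP.
    by apply: G0; rewrite -px; apply: graph_poly.
  - by rewrite size_map.
  have : y \in undup s by rewrite mem_undup rs.
  by rewrite -e => /mapP[x _ ->]; exists x.
pose g y := sval (cid (f_surj y)).
have gK : cancel g f by move=> y; exact: svalP (cid (f_surj y)).
have fK : cancel f g by move=> x; apply: f_inj; rewrite gK.
by exists (GaloisAut fK gK fB fM f1 fi).
Qed.

(** If [b] is not in [K], its minimal polynomial has another root [b'], by
    separability, and the embedding [b |-> b'] extends to an automorphism. *)
Lemma galois_fixed b : (forall t : galois_group iota, t b = b) ->
  exists a, b = iota a.
Proof.
move=> fixb; have [alg closed] := Lclosure.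
have [p [mon irr sep pb]] := alg b.
have p0 : map_poly iota p != 0 by rewrite map_poly_eq0 irredp_neq0.
have [q qE] := factor_theorem _ _ pb.
have q0 : q != 0 by apply: contra_neq p0; rewrite qE => ->; rewrite mul0r.
have sizeE : size p = (size q).+1.
  by rewrite -(size_map_poly iota) qE size_Mmonic ?monicXsubC // size_XsubC addn2.
have sepq : separable_poly (map_poly iota p) by rewrite separable_map.
have [q1|q1] := leqP (size q) 1.
  have q1E : q = 1.
    have := monic_map iota mon.
    rewrite qE monicMr ?monicXsubC // (size1_polyC q1) monicE lead_coefC => /eqP->.
    by [].
  exists (- p`_0).
  have : (map_poly iota p)`_0 = - b by rewrite qE q1E mul1r coefB coefX coefC sub0r.
  by rewrite coef_map /= => e; rewrite rmorphN e opprK.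
have [|b' qb'] := closed q q1.
  by apply: dvdp_separable sepq; rewrite qE dvdp_mulr.
have bb' : b' != b.
  apply: contraTneq qb' => ->; move: sepq; rewrite qE separable_root.
  by case/andP.
have pb' : root (map_poly iota p) b' by rewrite qE rootM qb'.
have conj r : root (map_poly iota r) b -> root (map_poly iota r) b'.
  move=> rb; have dp : gcdp p r %= p.
    apply: irr (dvdp_gcdl p r); apply/negP => /size_poly1P[c c0 gE].
    have : root (map_poly iota (gcdp p r)) b by rewrite gcdp_map root_gcd pb.
    by rewrite gE map_polyC rootC fmorph_eq0 (negPf c0).
  have pr : p %| r by rewrite -(eqp_dvdl r dp) dvdp_gcdr.
  by rewrite -(divpK pr) rmorphM /= rootM pb' orbT.
have hG0 : embedding_graph iota (adjoin_graph iota iota b b').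
  exact: (@adjoin_graphP _ _ _ _ _ _ id).
have [G [hG G0G Gtot]] := embedding_total alg closed hG0.
have [t tP] := graph_automorphism hG Gtot.
have : t b = b'.
  apply: (graph_functional hG (tP b)); apply: G0G.
  by exists 'X => //; rewrite !map_polyX !hornerX.
by rewrite fixb => e; rewrite e eqxx in bb'.
Qed.
End Galois.

(** * Quadratic characters of the Galois group *)

Section Characters.
Variables (K L : fieldType) (iota : {rmorphism K -> L}).
Hypothesis Lclosure : separable_closure iota.
Local Notation Gal := (galois_group iota).

HB.instance Definition _ (t : Gal) :=
  GRing.isZmodMorphism.Build L L (gaut_fun t) (gautB t).
HB.instance Definition _ (t : Gal) :=
  GRing.isMonoidMorphism.Build L L (gaut_fun t) (gaut1 t, gautM t).

(** The continuous homomorphisms to a group of order 2, written additively on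
    [bool]. An open subgroup is one that contains the pointwise stabilizer of a
    finite list. *)
Definition smooth_character : set (Gal -> bool) :=
  [set chi | (forall s t, chi (s * t)%g = chi s (+) chi t) /\
    exists S : seq L, forall t : Gal, (forall x, x \in S -> t x = x) -> ~~ chi t].

(** Each entry moves among the roots of a polynomial over [K]. *)
Lemma finite_orbit (S : seq L) :
  finite_set (range (fun t : Gal => [seq t x | x <- S])).
Proof.
elim: S => [|x S IH].
  by apply: (sub_finite_set _ (finite_set1 [::])) => _ [t _ <-].
have [p [_ irr _ px]] := Lclosure.1 x.
have p0 : map_poly iota p != 0 by rewrite map_poly_eq0 irredp_neq0.
apply: sub_finite_set (finite_image2 cons (finite_roots p0) IH).
move=> _ [t _ <-]; exists (t x); last by exists [seq t y | y <- S] => //; exists t.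
rewrite /= -(fmorph_root t) -map_poly_comp in px.
by rewrite (eq_map_poly (g := iota)) // in px => a; exact: gaut_fix.
Qed.

Section Eigenvector.
Variables (chi : Gal -> bool) (S : seq L).
Hypothesis chiM : forall s t : Gal, chi (s * t)%g = chi s (+) chi t.
Hypothesis chi_smooth : forall t : Gal, (forall x, x \in S -> t x = x) -> ~~ chi t.

Lemma character1 : chi 1%g = false.
Proof. by have := chiM 1%g 1%g; rewrite mulg1; case: (chi _). Qed.

Lemma characterV t : chi t^-1%g = chi t.
Proof.
by have := chiM t t^-1%g; rewrite mulgV character1; case: (chi t); case: (chi _).
Qed.

(* Kronecker's device: [Theta] plays the role of a primitive element, since an
   automorphism fixes [Theta] exactly when it fixes [S] pointwise. *)
Let Theta := Poly S.
Let orbit : set {poly L} := [set map_poly t Theta | t in [set t : Gal | ~~ chi t]].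

Let finite_ker_orbit : finite_set orbit.
Proof.
apply: sub_finite_set (finite_image Poly (finite_orbit S)) => _ [t _ <-].
by exists [seq t x | x <- S]; [exists t | rewrite map_Poly].
Qed.

(* Its coefficients are fixed by the kernel of [chi], and the kernel is the whole
   stabilizer of [F]. *)
Let F : {poly {poly L}} := \prod_(theta <- fset_set orbit) ('X - theta%:P).

Let F_root theta : root F theta = (theta \in orbit).
Proof. by rewrite root_prod_XsubC in_fset_set. Qed.

Let ker_fixes_F h : ~~ chi h -> map_poly (map_poly h) F = F.
Proof.
move=> hker; rewrite rmorph_prod /=.
under eq_bigr do rewrite rmorphB /= map_polyX map_polyC /=.
rewrite -(big_map (map_poly h) xpredT (fun theta => 'X - theta%:P)).
have Fu := fset_uniq (fset_set orbit).
have [|||_ e] := @uniq_min_size _ (map (map_poly h) (fset_set orbit))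
  (fset_set orbit).
- by rewrite map_inj_uniq //; exact: map_poly_inj.
- move=> _ /mapP[theta + ->]; rewrite !in_fset_set // !inE => -[t tker <-].
  exists (h * t)%g; first by rewrite /= chiM (negPf hker) (negPf tker).
  by rewrite -map_poly_comp.
- by rewrite size_map.
apply: perm_big; apply: uniq_perm => //.
by rewrite map_inj_uniq //; exact: map_poly_inj.
Qed.

(* A fixed [F] would have [t Theta] as a root, so [t] would agree on [S] with an
   element of the kernel. *)
Let F_moved t : chi t -> map_poly (map_poly t) F != F.
Proof.
move=> chit; apply/eqP => tF.
have : root F (map_poly t Theta).
  rewrite -tF rootE horner_map; apply/eqP; rewrite (_ : F.[Theta] = 0) ?rmorph0 //.
  apply/rootP; rewrite F_root inE; exists 1%g; first by rewrite /= character1.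
  by apply/polyP => i; rewrite coef_map.
rewrite F_root inE => -[h hker ht].
have /negP[] : ~~ chi (h^-1 * t)%g.
  apply: chi_smooth => x /(nthP 0)[i iS <-].
  have := congr1 (fun q : {poly L} => q`_i) ht; rewrite !coef_map coef_Poly /= => e.
  by rewrite -e gaut_funK.
by rewrite chiM characterV (negPf hker) chit.
Qed.

(** For a nontrivial [chi], some coefficient [u] of [F] is fixed by the kernel and
    moved by the other coset, all of whose elements send [u] to the same
    [tau u]; then [u - tau u] is an eigenvector. *)
Lemma character_eigenvector :
  exists2 b, b != 0 & forall t : Gal, t b = (-1) ^+ chi t * b.
Proof.
have [[tau ctau]|triv] := pselect (exists t, chi t); last first.
  exists 1; rewrite ?oner_neq0 // => t; rewrite gaut1.
  by case: (boolP (chi t)) => [ct|]; [case: triv; exists t | rewrite mul1r].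
have [u uker utau] : exists2 u : L, forall h, ~~ chi h -> h u = u & tau u != u.
  apply: contrapT => nu; move/eqP: (F_moved ctau); apply.
  apply/polyP => i; apply/polyP => j; rewrite !coef_map /=; apply: contrapT => ne.
  apply: nu; exists F`_i`_j; last exact/eqP.
  by move=> h /ker_fixes_F hF; rewrite -{2}hF !coef_map.
have odd_u t : chi t -> t u = tau u.
  move=> ct; have -> : t u = tau ((tau^-1 * t)%g u) by rewrite /= gaut_invK.
  by rewrite uker // chiM characterV ctau ct.
exists (u - tau u); first by rewrite subr_eq0 eq_sym.
move=> t; rewrite rmorphB /=; case: (boolP (chi t)) => ct.
- rewrite odd_u // expr1 mulN1r opprB; congr (_ - _).
  by apply: (uker (t * tau)%g); rewrite chiM ct ctau.
- rewrite uker // mul1r; congr (_ - _).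
  by apply: (odd_u (t * tau)%g); rewrite chiM ctau (negPf ct).
Qed.

End Eigenvector.

(** Kummer theory: if [b] is an eigenvector of [chi] then [b ^+ 2] is fixed, hence
    comes from [K], and up to a factor in [K] it may be replaced by a fixed
    square root [beta r] of a representative [r] of its square class. So [chi] is
    determined by [r]. *)
Lemma finite_smooth_characters (R : seq K) : (2%:R : K) != 0 ->
  (forall a, a != 0 -> exists r c, [/\ r \in R, c != 0 & a = r * c ^+ 2]) ->
  finite_set smooth_character.
Proof.
move=> two sqR.
have two' : (2%:R : L) != 0 by rewrite -(rmorph_nat iota) fmorph_eq0.
pose beta r : L :=
  if pselect (exists y, y ^+ 2 = iota r) is left e then sval (cid e) else 0.
have betaP r y : y ^+ 2 = iota r -> beta r ^+ 2 = iota r.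
  move=> yr; rewrite /beta; case: pselect => [e|[]]; last by exists y.
  exact: svalP (cid e).
pose kummer r (t : Gal) := t (beta r) != beta r.
apply: sub_finite_set (finite_image kummer (finite_seq R)).
move=> chi [chiM [S chiS]].
have [b b0 tb] := character_eigenvector chiM chiS.
have [a aE] : exists a, b ^+ 2 = iota a.
  apply: (galois_fixed Lclosure) => t.
  by rewrite rmorphXn /= tb exprMn sqrr_sign mul1r.
have a0 : a != 0 by rewrite -(fmorph_eq0 iota) -aE sqrf_eq0.
have [r [c [rR c0 arc]]] := sqR a a0.
exists r => //; apply/funext => t; rewrite /kummer.
have ic0 : iota c != 0 by rewrite fmorph_eq0.
have br : (b / iota c) ^+ 2 = iota r.
  by rewrite exprMn aE arc rmorphM rmorphXn /= exprVn mulfK // expf_neq0.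
have tbeta : t (beta r) = (-1) ^+ chi t * beta r.
  have : beta r ^+ 2 == (b / iota c) ^+ 2 by rewrite (betaP _ _ br) br.
  have e : t (b / iota c) = (-1) ^+ chi t * (b / iota c).
    by rewrite rmorphM fmorphV /= tb gaut_fix mulrA.
  by rewrite eqf_sqr => /orP[] /eqP->; rewrite ?rmorphN /= e ?mulrN.
have beta0 : beta r != 0.
  rewrite -sqrf_eq0 (betaP _ _ br) fmorph_eq0; apply: contra_neq a0 => r0.
  by rewrite arc r0 mul0r.
rewrite tbeta; case: (chi t); last by rewrite mul1r eqxx.
by rewrite expr1 mulN1r -subr_eq0 -opprD oppr_eq0 -mulr2n -mulr_natl mulf_neq0.
Qed.

End Characters.

(** * Signs on the levels of the tree *)

Section TreeSigns.
Variable d : nat.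
Implicit Types (s t : tree_aut d) (u w : vertex d).

(** An automorphism sends children of [w] to children of [t w]: a neighbour of
    [t w] is either a child or the parent of [t w], and the parent is the image
    of the parent of [w]. *)
Lemma tree_rcons t w a : exists b, t (rcons w a) = rcons (t w) b.
Proof.
have step u b : adjacent (t u) (t (rcons u b)).
  by apply/tree_adj; exists b; left.
elim/last_ind: w a => [|w c IH] a.
  have [b []] := step [::] a; rewrite tree_root; first by exists b.
  by case: (t [:: a]).
have [e te] := IH c; have [b [->|]] := step (rcons w c) a; first by exists b.
rewrite te => /rcons_inj[/(can_inj (tree_funK t)) /(congr1 size)].
by rewrite !size_rcons; lia.
Qed.

Lemma size_tree t u : size (t u) = size u.
Proof.
elim/last_ind: u => [|u a IH]; first by rewrite tree_root.
by have [b ->] := tree_rcons t u a; rewrite !size_rcons IH.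
Qed.

Lemma level_subproof n t (u : n.-tuple 'I_d) : size (t u) == n.
Proof. by rewrite size_tree size_tuple. Qed.

Definition level_map n t (u : n.-tuple 'I_d) := Tuple (level_subproof t u).

Lemma level_map_inj n t : injective (@level_map n t).
Proof.
by move=> u w /(congr1 val) /= /(can_inj (tree_funK t)) /val_inj.
Qed.

Definition level_perm n t := perm (@level_map_inj n t).

(** Through the coercion from permutations to [bool], true when the permutation
    is odd. *)
Definition level_sign n t : bool := level_perm n t.

Lemma level_signM n s t :
  level_sign n (s * t)%g = level_sign n s (+) level_sign n t.
Proof.
rewrite /level_sign addbC -odd_permM; congr odd_perm.
by apply/permP => u; rewrite permM !permE; apply: val_inj.
Qed.

Lemma eq_level_sign n s t :
  (forall u, size u = n -> s u = t u) -> level_sign n s = level_sign n t.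
Proof.
move=> st; congr odd_perm; apply/permP => u; rewrite !permE.
by apply: val_inj => /=; rewrite st // size_tuple.
Qed.

Lemma level_sign1 n : level_sign n 1%g = false.
Proof. by have := level_signM n 1%g 1%g; rewrite mulg1; case: level_sign. Qed.

Variables i0 i1 : 'I_d.

(** At the vertex [nseq k i0], exchange the subtrees above the children [i0] and
    [i1]. *)
Fixpoint swap_fun k u : vertex d :=
  match k, u with
  | _, [::] => [::]
  | 0, x :: u' => tperm i0 i1 x :: u'
  | k'.+1, x :: u' => x :: if x == i0 then swap_fun k' u' else u'
  end.

Lemma swap_funK k : involutive (swap_fun k).
Proof.
elim: k => [|k IH] [|x u] //=; first by rewrite tpermK.
by congr cons; case: eqP => // _; rewrite IH.
Qed.

Lemma swap_rcons k u a : exists b, swap_fun k (rcons u a) = rcons (swap_fun k u) b.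
Proof.
elim: k u => [|k IH] [|x u] /=.
- by exists (tperm i0 i1 a).
- by exists a.
- by exists a; case: ifP; case: k {IH}.
by case: ifP => _; [have [b ->] := IH u; exists b | exists a].
Qed.

Lemma swap_adjacent k u w : adjacent u w -> adjacent (swap_fun k u) (swap_fun k w).
Proof.
move=> [a [->|->]].
  by have [b ->] := swap_rcons k u a; exists b; left.
by have [b ->] := swap_rcons k w a; exists b; right.
Qed.

Definition swap (k : nat) : tree_aut d.
Proof.
apply: (@TreeAut d (swap_fun k) (swap_fun k) (swap_funK k) (swap_funK k)).
  by case: k.
move=> u w; split=> [|/swap_adjacent//].
by move=> /(swap_adjacent k); rewrite !swap_funK.
Defined.

Lemma swap_low k u : (size u <= k)%N -> swap k u = u.
Proof.
rewrite /=; elim: k u => [|k IH] [|x u] //= uk; rewrite IH //.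
by case: ifP.
Qed.

Lemma swap_level k u : size u = k.+1 -> swap k u =
  if u == rcons (nseq k i0) i0 then rcons (nseq k i0) i1 else
  if u == rcons (nseq k i0) i1 then rcons (nseq k i0) i0 else u.
Proof.
rewrite /=; elim: k u => [|k IH] [|x u] //= [su].
  case: u su => // _; rewrite !eqseq_cons !andbT.
  case: tpermP => [->|->|/eqP/negPf-> /eqP/negPf->//]; rewrite ?eqxx //.
  by case: eqP => // ->.
rewrite !eqseq_cons; case: eqP => // -> /=; rewrite IH //.
by case: ifP => // _; case: ifP.
Qed.

Hypothesis i01 : i0 != i1.

Lemma level_sign_swap_low n k : (n <= k)%N -> level_sign n (swap k) = false.
Proof.
move=> nk; rewrite -(level_sign1 n); apply: eq_level_sign => u un.
by rewrite swap_low // un.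
Qed.

Lemma level_sign_swap k : level_sign k.+1 (swap k).
Proof.
have tP a : size (rcons (nseq k i0) a) == k.+1 by rewrite size_rcons size_nseq.
rewrite /level_sign (_ : level_perm _ _ = tperm (Tuple (tP i0)) (Tuple (tP i1))).
  rewrite odd_tperm; apply: contra_neq i01 => /(congr1 val) /= /rcons_inj[].
  by [].
apply/permP => u; rewrite permE; apply: val_inj => /=.
rewrite [LHS](@swap_level k u) ?size_tuple //.
case: tpermP => [->|->|/eqP u0 /eqP u1] /=; rewrite ?eqxx //.
  by case: eqP => [->|].
by rewrite -!val_eqE /= in u0 u1; rewrite (negPf u0) (negPf u1).
Qed.

End TreeSigns.

(** * Continuity and pigeonhole *)

Lemma multiplicative1 (G H : groupType) (f : {multiplicative G -> H}) :
  f 1%g = 1%g.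
Proof. by apply: (mulgI (f 1%g)); rewrite -gmulfM !mulg1. Qed.

Section Continuity.
Variables (K L : fieldType) (iota : {rmorphism K -> L}).
Local Notation Gal := (galois_group iota).

(** A basic neighbourhood of 1 is a finite intersection of cosets through 1 of
    groups fixing a finite extension, and fixing a spanning list of each of the
    extensions is enough. *)
Lemma krull_nbhs1 (V : set Gal) : nbhs (1%g : Gal) V -> exists S : seq L,
  forall t : Gal, (forall x, x \in S -> t x = x) -> V t.
Proof.
rewrite nbhsE => -[B [openB B1] BV].
case: openB => /= F FD FB.
move: B1; rewrite -FB => -[U FU U1].
have [D DK DU] := FD _ FU.
have DS W : W \in enum_fset D -> exists S : seq L,
    forall t : Gal, (forall x, x \in S -> t x = x) -> W t.
  move=> WD; have W1 : W 1%g by rewrite -DU in U1; exact: U1.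
  have := DK _ WD; rewrite inE => -[s [E [[_ _ [S ES]] WE]]].
  exists S => t tS; have tE x : x \in E -> t x = x.
    move=> /ES[c ->]; elim/big_rec: _ => [|i y _ yt].
      by have := gautB t 0 0; rewrite !subr0 subrr.
    by rewrite rmorphD rmorphM /= gaut_fix tS ?mem_nth // yt.
  rewrite WE in W1 *; case: W1 => r rE sr1.
  have -> : t = (s * (r * t))%g by rewrite mulgA sr1 mul1g.
  by exists (r * t)%g => // x xE; rewrite /= tE // rE.
have [S SD] : exists S : seq L, forall t : Gal, (forall x, x \in S -> t x = x) ->
    forall W, W \in enum_fset D -> W t.
  elim: (enum_fset D) DS => [|W Ds IH] DS; first by exists [::].
  have [S SW] := DS W (mem_head _ _).
  have [|S' SD] := IH; first by move=> W' W'D; apply: DS; rewrite inE W'D orbT.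
  exists (S ++ S') => t tS W'; rewrite inE => /predU1P[->|].
    by apply: SW => x xS; apply: tS; rewrite mem_cat xS.
  by apply: SD => x xS; apply: tS; rewrite mem_cat xS orbT.
exists S => t tS; apply: BV; rewrite -FB; exists U => //; rewrite -DU.
by move=> W; exact: SD.
Qed.

Variables (d : nat) (rho : {multiplicative galois_group iota -> tree_aut d}).
Hypothesis rho_cont : continuous rho.

(** [level_sign n] is constant on the fibres of the restriction to [T_n]. *)
Lemma level_sign_smooth n : smooth_character (level_sign n \o rho : Gal -> bool).
Proof.
split=> [s t|]; first by rewrite /= gmulfM level_signM.
pose U : set (tree_aut d) :=
  [set t | forall u : vertex d, (size u <= n)%N -> t u = (1%g : tree_aut d) u].
have nU : nbhs (rho 1%g) U.
  rewrite multiplicative1 nbhsE; exists U => //; split=> //.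
  exists [set U]; last by rewrite bigcup_set1.
  by move=> _ ->; apply: finI_from1; exists 1%g, n.
have [S SU] := krull_nbhs1 (rho_cont nU).
exists S => t /SU tU; rewrite /= (@eq_level_sign _ _ _ 1%g) ?level_sign1 //.
by move=> u un; apply: tU; rewrite un.
Qed.

End Continuity.

Lemma infinite_fibre (T : Type) (f : nat -> T) (A : set T) :
  finite_set A -> range f `<=` A -> exists a, infinite_set [set n | f n = a].
Proof.
move=> finA fA; apply: contrapT => nfib; apply: infinite_nat.
apply: (@sub_finite_set _ _ (\bigcup_(a in A) [set n | f n = a])).
  by move=> n _; exists (f n) => //; apply: fA; exists n.
apply: bigcup_finite => // a _; apply: contrapT => ia.
by apply: nfib; exists a.
Qed.

Lemma infinite_above (D : set nat) m : infinite_set D -> exists2 n, D n & (m < n)%N.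
Proof.
move=> Dinf; apply: contrapT => nD; apply: Dinf.
apply: sub_finite_set (finite_II m.+1) => n Dn /=.
by rewrite ltnS leqNgt; apply/negP => mn; apply: nD; exists n.
Qed.

Theorem theorem2p1 (K : fieldType) (v : discrete_valuation K)
    (v_complete : valuation_complete v)
    (residue_finite : finite_set [set: residue_field v])
    (charK : 2%N \notin [pchar K])
    (d : nat) (d_ge2 : (2 <= d)%N)
    (Ks : fieldType) (iota : {rmorphism K -> Ks})
    (Ks_closure : separable_closure iota)
    (rho : {multiplicative galois_group iota -> tree_aut d})
    (rho_cont : continuous rho) :
  infinite_index (range rho).
Proof.
have two : (2%:R : K) != 0.
  by apply: contra charK => two; rewrite inE.
have [R sqR] := finite_square_classes v_complete two residue_finite.
have finX := finite_smooth_characters Ks_closure two sqR.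
pose i0 := Ordinal (ltnW d_ge2); pose i1 : 'I_d := Ordinal d_ge2.
have i01 : i0 != i1 by [].
move=> finC.
pose swapcoset n : set (tree_aut d) := [set (swap i0 i1 n * h)%g | h in range rho].
pose phi n := (level_sign n.+1 \o rho, swapcoset n).
have [|p Dinf] := @infinite_fibre _ phi _ (finite_setX finX finC).
  move=> _ [n _ <-]; split; first exact: level_sign_smooth.
  by exists (swap i0 i1 n).
have [m Dm _] := infinite_above 0 Dinf.
have [k Dk mk] := infinite_above m Dinf.
have [l Dl kl] := infinite_above k Dinf.
have signE : level_sign m.+1 \o rho = level_sign k.+1 \o rho.
  by have [] : phi m = phi k by rewrite Dm Dk.
have [_ coset] : phi k = phi l by rewrite Dk Dl.
have : swapcoset k (swap i0 i1 k).
  by exists 1%g; rewrite ?mulg1 //; exists 1%g; rewrite ?multiplicative1.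
rewrite coset => -[_ [s _ <-] e].
have even_s : level_sign m.+1 (rho s) = false.
  have := congr1 (level_sign m.+1) e.
  by rewrite level_signM !level_sign_swap_low // (ltn_trans mk kl).
have odd_s : level_sign k.+1 (rho s).
  have := congr1 (level_sign k.+1) e.
  by rewrite level_signM level_sign_swap // (level_sign_swap_low _ _ kl).
have := congr1 (fun chi => chi s) signE.
by rewrite /= even_s odd_s.
Qed.
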